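(* Let $h$ be an admissible discretization step. Assume that the numerical Hamiltonian $g=(g_j)_{j\in J}$ satisfies (G1)--(G5) (listed in the context) and that the operator $V_h$ is strictly monotone, i.e. for all $M,\bar M\in\mathcal K_h$, $$(V_h[M]-V_h[\bar M],M-\bar M)_2\le 0\ \Rightarrow\ M=\bar M.$$ Then the problem: find grid functions $U,M$ and $\Lambda\in\mathbb R$ such that $$ \begin{cases} -\nu_j (D^2_h U)_{j,k}+g(x_{j,k},[D_hU]_{j,k})+\Lambda=(V_h[M])_{j,k}, & k=1,\dots,N^h_j-1,\ j\in J,\\ \nu_j(D^2_hM)_{j,k}+\mathcal B^h(U,M)_{j,k}=0, & k=1,\dots,N^h_j-1,\ j\in J,\\ \mathcal S^h(U,V_h[M]-\Lambda)_i=0,\quad \mathcal T^h(M,U)_i=0,\quad U \text{ continuous at } v_i, & i\in I,\\ M\in\mathcal K_h,\qquad (U,1)_2=0, \end{cases} $$ has at most one solution $(U,M,\Lambda)$.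
   Context: Network. $\Gamma=(\mathcal V,\mathcal E)$ is a connected network: a finite set of vertices $\mathcal V=\{v_i\}_{i\in I}\subset\mathbb R^n$ and a finite collection $\mathcal E=\{e_j\}_{j\in J}$ of continuous non self-intersecting arcs with endpoints in $\mathcal V$; $e_j$ is parametrized by a smooth $\pi_j:[0,l_j]\to\mathbb R^n$, $l_j>0$. The network has no boundary, i.e. transition conditions are imposed at every vertex. $\nu_j>0$, $j\in J$, are given. $\mathrm{Inc}_i^+=\{j: v_i=\pi_j(0)\}$, $\mathrm{Inc}_i^-=\{j: v_i=\pi_j(l_j)\}$, $\mathrm{Inc}_i=\mathrm{Inc}_i^+\cup \mathrm{Inc}_i^-$ (edges incident to $v_i$). Grid. A discretization step is $h=(h_j)_{j\in J}$, $h_j>0$, with $N^h_j=l_j/h_j$ an integer ($\ge 2$); $y_{j,k}=kh_j$, $x_{j,k}=\pi_j(y_{j,k})$, $0\le k\le N^h_j$. A grid function is a family $U=(U_{j,k})_{j\in J,\,0\le k\le N_j^h}$. It is continuous at $v_i$ if its values at all the grid indices corresponding to $v_i$ (index $(j,0)$ for $j\in\mathrm{Inc}_i^+$, index $(j,N^h_j)$ for $j\in\mathrm{Inc}_i^-$) coincide; it is continuous if it is continuous at every $v_i$. Constants are identified with constant grid functions. Operators. $(D^+U)_{j,k}=(U_{j,k+1}-U_{j,k})/h_j$; $[D_hU]_{j,k}=((D^+U)_{j,k},(D^+U)_{j,k-1})^T$; $(D^2_hU)_{j,k}=(U_{j,k-1}-2U_{j,k}+U_{j,k+1})/h_j^2$.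 $$(U,W)_2=\sum_{j\in J}\sum_{k=1}^{N^h_j-1}h_jU_{j,k}W_{j,k}+\sum_{i\in I}\Big(\sum_{j\in\mathrm{Inc}_i^+}\tfrac{h_j}{2}U_{j,0}W_{j,0}+\sum_{j\in\mathrm{Inc}_i^-}\tfrac{h_j}{2}U_{j,N^h_j}W_{j,N^h_j}\Big).$$ $\mathcal K_h=\{M \text{ continuous grid function}: M_{j,k}\ge0,\ (M,1)_2=1\}$; $V_h$ is an operator mapping $\mathcal K_h$ to grid functions. $$\mathcal S^h(U,V)_i=\sum_{j\in\mathrm{Inc}_i^+}\big[\nu_j(D^+U)_{j,0}+\tfrac{h_j}{2}V_{j,0}\big]-\sum_{j\in\mathrm{Inc}_i^-}\big[\nu_j(D^+U)_{j,N^h_j-1}-\tfrac{h_j}{2}V_{j,N^h_j}\big],$$ $$\mathcal T^h(M,U)_i=\sum_{j\in\mathrm{Inc}_i^+}\big[\nu_j(D^+M)_{j,0}+M_{j,1}\tfrac{\partial g}{\partial q_2}(x_{j,1},[D_hU]_{j,1})\big]-\sum_{j\in\mathrm{Inc}_i^-}\big[\nu_j(D^+M)_{j,N^h_j-1}+M_{j,N^h_j-1}\tfrac{\partial g}{\partial q_1}(x_{j,N^h_j-1},[D_hU]_{j,N^h_j-1})\big].$$ For $k=1,\dots,N_j^h-1$, with $g^s_{j,k}:=\frac{\partial g}{\partial q_s}(x_{j,k},[D_hU]_{j,k})$, $s=1,2$, $$\mathcal B^h(U,M)_{j,k}=\tfrac1{h_j}\big[M_{j,k}g^1_{j,k}-M_{j,k-1}g^1_{j,k-1}+M_{j,k+1}g^2_{j,k+1}-M_{j,k}g^2_{j,k}\big],$$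 where the term $M_{j,k-1}g^1_{j,k-1}$ is omitted when $k=1$ and the term $M_{j,k+1}g^2_{j,k+1}$ is omitted when $k=N^h_j-1$. Hamiltonians. $H_j:[0,l_j]\times\mathbb R\to\mathbb R$, $j\in J$, are continuous and convex in the second variable. The numerical Hamiltonians are $g_j:[0,l_j]\times\mathbb R^2\to\mathbb R$, $(x,q_1,q_2)\mapsto g_j(x,q_1,q_2)$, and $g(x_{j,k},\cdot)$ means $g_j(y_{j,k},\cdot)$. Assumptions: (G1) $g_j$ is nonincreasing in $q_1$ and nondecreasing in $q_2$. (G2) $g_j(x,q,q)=H_j(x,q)$ for all $x\in[0,l_j]$, $q\in\mathbb R$. (G3) $g_j$ is of class $C^1$. (G4) $g_j(x,q_1,q_2)\ge\alpha((q_1^-)^2+(q_2^+)^2)^{\gamma/2}-C$ for some $\alpha>0$, $C\in\mathbb R$, $\gamma>1$, where $q^+=\max(q,0)$, $q^-=\max(-q,0)$. (G5) for all $x$, $(q_1,q_2)\mapsto g_j(x,q_1,q_2)$ is convex. *)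

(* Defs.v *)
From HB Require Import structures.
From mathcomp Require Import all_boot all_order all_algebra.
From mathcomp Require Import all_classical all_reals all_analysis.

Set Implicit Arguments.
Unset Strict Implicit.
Unset Printing Implicit Defensive.

Import Order.TTheory GRing.Theory Num.Theory.
Import numFieldNormedType.Exports.

Local Open Scope classical_set_scope.
Local Open Scope ring_scope.

Section Regularity.
Context {R : realType}.

(* Regularity on a set A with boundary (a closed interval or a closed slab
   below) is understood as being the restriction to A of a function having
   that regularity on the whole space. *)
Definition smooth_on (V : normedModType R) (A : set R) (f : R -> V) : Prop :=
  exists F : R -> V,
    {in A, f =1 F} /\ forall (m : nat) (t : R), derivable (derive1n m F) t 1.

Definition C1_on (V : normedModType R) (A : set V) (f : V -> R) : Prop :=
  exists F : V -> R,
    [/\ {in A, f =1 F}, forall p, differentiable F p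
      & forall v : V, continuous (fun p => 'D_v F p)].

End Regularity.

(* A network without boundary: every vertex is a transition vertex. An arc may
   be a loop: 0 and [len j] are the only two parameters of a given arc that
   may be sent to the same point. *)
Record network (R : realType) (n : nat) (I J : finType) := Network {
  vert : I -> 'rV[R]_n;
  vert_inj : injective vert;
  len : J -> R;
  len_gt0 : forall j, 0 < len j;
  par : J -> R -> 'rV[R]_n;
  par_smooth : forall j, smooth_on `[0, len j] (par j);
  par_simple : forall j (s t : R), s \in `[0, len j] -> t \in `[0, len j] ->
    s < t -> par j s = par j t -> s = 0 /\ t = len j;
  par_start : forall j, exists i, par j 0 = vert i;
  par_end : forall j, exists i, par j (len j) = vert i }.

Section Incidence.
Context {R : realType} {n : nat} {I J : finType} (G : network R n I J).

Definition Inc_plus (i : I) : {set J} := [set j | vert G i == par G j 0].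
Definition Inc_minus (i : I) : {set J} :=
  [set j | vert G i == par G j (len G j)].
Definition Inc (i : I) : {set J} := Inc_plus i :|: Inc_minus i.

Definition adjacent : rel I :=
  fun i i' => [exists j, (j \in Inc i) && (j \in Inc i')].

Definition connected_network : Prop := forall i i', connect adjacent i i'.

End Incidence.

Record discretization (R : realType) (J : finType) (l : J -> R) :=
  Discretization {
    step : J -> R;
    npts : J -> nat;
    step_gt0 : forall j, 0 < step j;
    nptsE : forall j, (npts j)%:R = l j / step j;
    npts_ge2 : forall j, (2 <= npts j)%N }.

(* Grid functions are indexed by pairs (j, k) with 0 <= k <= N_j. *)
Definition grid_index (J : finType) (N : J -> nat) : Type :=
  {j : J & 'I_(N j).+1}.

Definition gridfun (R : realType) (J : finType) (N : J -> nat) : Type :=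
  {ffun {j : J & 'I_(N j).+1} -> R}.

(* Only meaningful for k <= N j: [inord] sends larger k to 0. *)
Definition gval (R : realType) (J : finType) (N : J -> nat)
    (U : gridfun R N) (j : J) (k : nat) : R :=
  U (Tagged (fun j => 'I_(N j).+1) (inord k : 'I_(N j).+1)).

Notation "U :[ j , k ]" := (gval U j k)
  (at level 2, j at level 200, k at level 200, format "U :[ j ,  k ]").

Definition cst_grid (R : realType) (J : finType) (N : J -> nat) (c : R)
  : gridfun R N := [ffun=> c].

Section Scheme.
Context {R : realType} {n : nat} {I J : finType} (G : network R n I J).
Context (D : discretization (len G)).

Local Notation h := (step D).
Local Notation N := (npts D).
Local Notation GF := (gridfun R N).

Definition ypt (j : J) (k : nat) : R := k%:R * h j.

Definition is_vertex_index (i : I) (p : grid_index N) : Prop :=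
  (tag p \in Inc_plus G i /\ tagged p = 0%N :> nat) \/
  (tag p \in Inc_minus G i /\ tagged p = N (tag p) :> nat).

Definition grid_continuous_at (U : GF) (i : I) : Prop :=
  forall p q, is_vertex_index i p -> is_vertex_index i q -> U p = U q.

Definition grid_continuous (U : GF) : Prop :=
  forall i, grid_continuous_at U i.

Definition Dplus (U : GF) (j : J) (k : nat) : R :=
  (U:[j, k.+1] - U:[j, k]) / h j.

Definition Dh (U : GF) (j : J) (k : nat) : R * R :=
  (Dplus U j k, Dplus U j k.-1).

Definition D2h (U : GF) (j : J) (k : nat) : R :=
  (U:[j, k.-1] - 2 * U:[j, k] + U:[j, k.+1]) / h j ^+ 2.

Definition inner2 (U W : GF) : R :=
  \sum_(j : J) \sum_(1 <= k < N j) h j * U:[j, k] * W:[j, k]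
  + \sum_(i : I)
      (\sum_(j in Inc_plus G i) h j / 2 * U:[j, 0] * W:[j, 0]
       + \sum_(j in Inc_minus G i) h j / 2 * U:[j, N j] * W:[j, N j]).

Definition Kh (M : GF) : Prop :=
  [/\ grid_continuous M, forall p, 0 <= M p & inner2 M (cst_grid N 1) = 1].

(* V_h acts on K_h; it is represented by a total operator of which only the
   values on K_h are ever used. *)
Definition strictly_monotone (V : GF -> GF) : Prop :=
  forall M M', Kh M -> Kh M' -> inner2 (V M - V M') (M - M') <= 0 -> M = M'.

Section Operators.
Context (nu : J -> R) (g : J -> R -> R * R -> R).

Definition gat (j : J) (k : nat) (q : R * R) : R := g j (ypt j k) q.

Definition dq1 (f : R * R -> R) (q : R * R) : R :=
  derive1 (fun s : R => f (s, q.2)) q.1.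
Definition dq2 (f : R * R -> R) (q : R * R) : R :=
  derive1 (fun s : R => f (q.1, s)) q.2.

Definition g1 (U : GF) (j : J) (k : nat) : R := dq1 (gat j k) (Dh U j k).
Definition g2 (U : GF) (j : J) (k : nat) : R := dq2 (gat j k) (Dh U j k).

Definition Sh (U V : GF) (i : I) : R :=
  \sum_(j in Inc_plus G i) (nu j * Dplus U j 0 + h j / 2 * V:[j, 0])
  - \sum_(j in Inc_minus G i)
      (nu j * Dplus U j (N j).-1 - h j / 2 * V:[j, N j]).

Definition Th (M U : GF) (i : I) : R :=
  \sum_(j in Inc_plus G i) (nu j * Dplus M j 0 + M:[j, 1] * g2 U j 1)
  - \sum_(j in Inc_minus G i)
      (nu j * Dplus M j (N j).-1 + M:[j, (N j).-1] * g1 U j (N j).-1).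

Definition Bh (U M : GF) (j : J) (k : nat) : R :=
  (h j)^-1 *
  (M:[j, k] * g1 U j k
   - (if k == 1%N then 0 else M:[j, k.-1] * g1 U j k.-1)
   + (if k == (N j).-1 then 0 else M:[j, k.+1] * g2 U j k.+1)
   - M:[j, k] * g2 U j k).

Definition mfg_solution (V : GF -> GF) (U M : GF) (L : R) : Prop :=
  [/\ forall j k, (1 <= k <= (N j).-1)%N ->
        - nu j * D2h U j k + gat j k (Dh U j k) + L = (V M):[j, k],
      forall j k, (1 <= k <= (N j).-1)%N ->
        nu j * D2h M j k + Bh U M j k = 0,
      forall i, [/\ Sh U (V M - cst_grid N L) i = 0, Th M U i = 0
                  & grid_continuous_at U i],
      Kh M
    & inner2 U (cst_grid N 1) = 0].

End Operators.
End Scheme.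

Section Hamiltonians.
Context {R : realType} {J : finType} (l : J -> R).

Definition is_hamiltonian (H : J -> R -> R -> R) : Prop := forall j,
  {within `[0, l j] `*` setT, continuous (fun p : R * R => H j p.1 p.2)} /\
  forall x : R, x \in `[0, l j] -> convex_function setT (H j x).

Context (g : J -> R -> R * R -> R).

Definition numH_monotone : Prop := forall j (x : R), x \in `[0, l j] ->
  (forall q1 q1' q2, q1 <= q1' -> g j x (q1', q2) <= g j x (q1, q2)) /\
  (forall q1 q2 q2', q2 <= q2' -> g j x (q1, q2) <= g j x (q1, q2')).

Definition numH_consistent (H : J -> R -> R -> R) : Prop :=
  forall j (x q : R), x \in `[0, l j] -> g j x (q, q) = H j x q.

Definition numH_C1 : Prop := forall j,
  C1_on (`[0, l j] `*` setT : set (R * (R * R))) (fun p => g j p.1 p.2).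

Definition pos_part (q : R) : R := Num.max q 0.
Definition neg_part (q : R) : R := Num.max (- q) 0.

Definition numH_coercive : Prop := exists alpha C gamma : R,
  [/\ 0 < alpha, 1 < gamma
    & forall j (x q1 q2 : R), x \in `[0, l j] ->
        alpha * (neg_part q1 ^+ 2 + pos_part q2 ^+ 2) `^ (gamma / 2) - C
          <= g j x (q1, q2)].

Definition numH_convex : Prop := forall j (x : R), x \in `[0, l j] ->
  convex_function setT (g j x).

End Hamiltonians.

(* Main.v *)
Require Import Defs.
From mathcomp Require Import all_boot all_order all_algebra.
From mathcomp Require Import all_classical all_reals all_analysis.
Import Order.TTheory GRing.Theory Num.Theory.
Import numFieldNormedType.Exports.
From mathcomp Require Import ring lra.

Set Implicit Arguments.
Unset Strict Implicit.
Unset Printing Implicit Defensive.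

Local Open Scope classical_set_scope.
Local Open Scope ring_scope.

(** The proof is the Lasry-Lions monotonicity argument followed by a strong
    maximum principle.

    Both equations of the system are discrete conservation laws on the network.
    On each edge the Hamilton-Jacobi equation says that the increment of the
    flux nu D^+U is a source, and S^h = 0 is the Kirchhoff balance of that flux
    at the vertices; the Fokker-Planck equation says that the flux
    nu D^+M + (drift) is constant along each edge, and T^h = 0 is its Kirchhoff
    balance.  Hence one Green formula, [network_Green], turns each equation
    plus its transition condition into a weak formulation tested against any
    continuous grid function ([hjb_tested], [fp_tested]).

    For two solutions, test the difference of the Hamilton-Jacobi equations
    with M - M' and the difference of the Fokker-Planck equations with U - U'.
    The second order terms are the same symmetric bilinear form [energy] and
    cancel, the constants disappear because M and M' have the same mass, and
    what is left is
      (V M - V M', M - M')_2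
        = sum h M (g(DU) - g(DU') - dg(DU).(DU - DU'))
          + sum h M' (g(DU') - g(DU) - dg(DU').(DU' - DU)),
    where both brackets are nonpositive by convexity ([convex_gradient]).
    Strict monotonicity then gives M = M'.

    Convexity is not strict, so this identity says nothing on U.  But U and U'
    now solve the same Hamilton-Jacobi problem, with constants L' <= L, say.
    At a maximum point of U - U', inside an edge or at a vertex, monotonicity
    of g makes all the terms of the difference of the equations have the same
    sign, so they vanish and the neighbours are maximum points too.  As the
    network is connected, U - U' is constant ([top_everywhere]), the
    normalization (U, 1)_2 = 0 makes this constant zero, and the equation at
    any grid point gives L = L' ([hjb_unique]). *)

(** * Convex differentiable functions of two variables *)

Lemma dq1E (R : realType) (f : R * R -> R) q : dq1 f q = 'D_(1, 0) f q.
Proof.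
rewrite /dq1 /derive1 /derive.
set F := fun h : R => _; set F' := fun h : R => _.
suff -> : F = F' by [].
apply/funext => s; rewrite {}/F {}/F' /=; case: q => a b /=.
have -> // : s *: (1, 0) + (a, b) = (s + a, b) :> R * R.
by congr pair => /=; [rewrite [_ *: 1]mulr1 | rewrite scaler0 add0r].
Qed.

Lemma dq2E (R : realType) (f : R * R -> R) q : dq2 f q = 'D_(0, 1) f q.
Proof.
rewrite /dq2 /derive1 /derive.
set F := fun h : R => _; set F' := fun h : R => _.
suff -> : F = F' by [].
apply/funext => s; rewrite {}/F {}/F' /=; case: q => a b /=.
have -> // : s *: (0, 1) + (a, b) = (a, s + b) :> R * R.
by congr pair => /=; [rewrite scaler0 add0r | rewrite [_ *: 1]mulr1].
Qed.

Lemma derive_dq (R : realType) (f : R * R -> R) q v : differentiable f q ->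
  'D_v f q = dq1 f q * v.1 + dq2 f q * v.2.
Proof.
move=> df; rewrite dq1E dq2E !deriveE//.
have {1}-> : v = v.1 *: (1, 0) + v.2 *: (0, 1) :> R * R.
  case: v => a b /=; congr pair => /=.
    by rewrite [_ *: 1]mulr1 scaler0 addr0.
  by rewrite [_ *: 1]mulr1 scaler0 add0r.
by rewrite linearD !linearZ /= ![_ *: 'd _ _ _]mulrC.
Qed.

(** Convexity bounds the difference quotients of [f] along the segment from
    [q] to [q'] by [f q' - f q], and the right limit at [q] of these quotients
    is the directional derivative. *)
Lemma convex_gradient (R : realType) (f : R * R -> R) q q' :
  convex_function setT f -> differentiable f q ->
  f q + (dq1 f q * (q'.1 - q.1) + dq2 f q * (q'.2 - q.2)) <= f q'.
Proof.
move=> fconv df; rewrite -(@derive_dq _ f q (q' - q))// addrC -lerBrDr.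
have : derivable f q (q' - q) by exact: diff_derivable.
rewrite /derivable => /cvg_dnbhs_at_right cvgD.
apply: (cvgr_to_le cvgD).
near=> s.
have s0 : 0 < s by near: s; exact: nbhs_right_gt.
have s1 : s < 1 by near: s; exact: nbhs_right_lt.
have := fconv (Itv01 (ltW s0) (ltW s1)) q' q.
rewrite !inE => /(_ Logic.I Logic.I).
rewrite /conv /= /conv /= /unstable.onem.
have -> : s *: q' + (1 - s) *: q = s *: (q' - q) + q.
  by rewrite scalerBl scalerBr scale1r addrA addrAC.
rewrite -!/(_ * _) => fs; rewrite [_ *: _]mulrC ler_pdivrMr// lerBlDr.
apply: le_trans fs _; rewrite [_ *: f q']mulrC [_ *: f q]mulrC; lra.
Unshelve. all: by end_near. Qed.

(** For fixed [x] in the interval the numerical Hamiltonian coincides, on the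
    whole plane, with a partial map of its [C^1] extension; so it is
    differentiable even when [x] is an end of the interval. *)
Lemma numH_differentiable (R : realType) (J : finType) (l : J -> R)
    (g : J -> R -> R * R -> R) j x q :
  numH_C1 l g -> x \in `[0, l j] -> differentiable (g j x) q.
Proof.
move=> /(_ j) [F [gF dF _]] xl.
have -> : g j x = F \o pair x.
  by apply/funext => r /=; apply: (gF (x, r)); rewrite inE.
by apply: differentiable_comp => //; exact: differentiable_pair.
Qed.

(** * Grid functions and summation by parts *)

Section Grid.
Context {R : realType} {n : nat} {I J : finType} (G : network R n I J).
Context (D : discretization (len G)).
Local Notation h := (step D).
Local Notation N := (npts D).
Local Notation GF := (gridfun R N).

Lemma gvalB (U W : GF) j k : (U - W):[j, k] = U:[j, k] - W:[j, k].
Proof. by rewrite /gval !ffunE. Qed.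

Lemma gval_cst (c : R) j k : (cst_grid N c):[j, k] = c.
Proof. by rewrite /gval ffunE. Qed.

Lemma gval_ext (U W : GF) :
  (forall j k, (k <= N j)%N -> U:[j, k] = W:[j, k]) -> U = W.
Proof.
move=> UW; apply/ffunP => -[j k]; have := UW j k; rewrite -ltnS ltn_ord.
by move=> /(_ isT); rewrite /gval inord_val.
Qed.

Lemma npts_gt0 j : (0 < N j)%N.
Proof. exact: ltn_trans (npts_ge2 D j). Qed.

Lemma ypt_in j k : (k <= N j)%N -> ypt D j k \in `[0, len G j].
Proof.
move=> kN; rewrite in_itv /= /ypt mulr_ge0 ?ler0n ?(ltW (step_gt0 D j))//=.
by rewrite -ler_pdivlMr ?(step_gt0 D j)// -nptsE ler_nat.
Qed.

Lemma Dplus_step (U : GF) j k : h j * Dplus U j k = U:[j, k.+1] - U:[j, k].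
Proof. by rewrite /Dplus mulrC divfK// gt_eqF// step_gt0. Qed.

Lemma DplusB (U W : GF) j k : Dplus (U - W) j k = Dplus U j k - Dplus W j k.
Proof. by rewrite /Dplus !gvalB; ring. Qed.

Lemma D2h_flux (U : GF) j k : (0 < k)%N ->
  h j * D2h U j k = Dplus U j k - Dplus U j k.-1.
Proof.
case: k => // k _; rewrite /D2h /Dplus /=; field.
by rewrite gt_eqF// step_gt0.
Qed.

(** Vertices are distinct points, so every arc starts at exactly one vertex. *)
Lemma sum_Inc_plus (F : J -> R) :
  \sum_i \sum_(j in Inc_plus G i) F j = \sum_j F j.
Proof.
rewrite (exchange_big_dep xpredT)//=; apply: eq_bigr => j _.
have [i0 ji0] := par_start G j.
rewrite (big_pred1 i0)// => i; rewrite inE ji0.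
by rewrite (inj_eq (@vert_inj _ _ _ _ G)).
Qed.

Lemma sum_Inc_minus (F : J -> R) :
  \sum_i \sum_(j in Inc_minus G i) F j = \sum_j F j.
Proof.
rewrite (exchange_big_dep xpredT)//=; apply: eq_bigr => j _.
have [i0 ji0] := par_end G j.
rewrite (big_pred1 i0)// => i; rewrite inE ji0.
by rewrite (inj_eq (@vert_inj _ _ _ _ G)).
Qed.

Lemma vertex_value (Z : GF) i : grid_continuous_at Z i -> exists c,
  (forall j, j \in Inc_plus G i -> Z:[j, 0] = c) /\
  (forall j, j \in Inc_minus G i -> Z:[j, N j] = c).
Proof.
move=> Zi; have [[p ip]|noP] :=
  pselect (exists p, is_vertex_index (D := D) i p).
  exists (Z p); split=> j ji; apply: Zi => //.
    by left; rewrite /= inordK.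
  by right; rewrite /= inordK.
(* No edge meets the vertex: any value will do. *)
exists 0; split=> j ji; case: noP.
  by exists (Tagged (i := j) (fun j => 'I_(N j).+1) ord0); left.
by exists (Tagged (i := j) (fun j => 'I_(N j).+1) ord_max); right.
Qed.

(** A Kirchhoff balance of incoming and outgoing fluxes can be multiplied by
    the common value of [Z] at each vertex. *)
Lemma Kirchhoff_test (Z : GF) (a b : J -> R) : grid_continuous Z ->
  (forall i, \sum_(j in Inc_plus G i) a j
     - \sum_(j in Inc_minus G i) b j = 0) ->
  \sum_j (a j * Z:[j, 0] - b j * Z:[j, N j]) = 0.
Proof.
move=> Zc ab; rewrite sumrB -sum_Inc_plus -[X in _ - X]sum_Inc_minus -sumrB.
apply: big1 => i _; have [c [Zp Zm]] := vertex_value (Zc i).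
rewrite (eq_bigr (fun j => a j * c)); last by move=> j /Zp ->.
rewrite [X in _ - X](eq_bigr (fun j => b j * c)); last by move=> j /Zm ->.
by rewrite -!mulr_suml -mulrBl ab mul0r.
Qed.

Lemma sum_by_parts (a w : nat -> R) m : (0 < m)%N ->
  \sum_(0 <= k < m) a k * (w k.+1 - w k) =
  a m.-1 * w m - a 0 * w 0 - \sum_(1 <= k < m) (a k - a k.-1) * w k.
Proof.
elim: m => // -[_ _|m IH _].
  by rewrite big_nat1 big_geq//= subr0 mulrBr.
by rewrite big_nat_recr//= IH// [in RHS]big_nat_recr//=; ring.
Qed.

(** Edge by edge summation by parts produces the boundary terms
    [a j (N j).-1 * Z:[j, N j] - a j 0 * Z:[j, 0]]; summed over the network,
    the transition conditions replace them by the vertex sources [c] and [d].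
    *)
Lemma network_Green (Z : GF) (a f : J -> nat -> R) (c d : J -> R) :
  grid_continuous Z ->
  (forall j k, (1 <= k <= (N j).-1)%N -> a j k - a j k.-1 = f j k) ->
  (forall i, \sum_(j in Inc_plus G i) (a j 0 + c j)
     - \sum_(j in Inc_minus G i) (a j (N j).-1 - d j) = 0) ->
  \sum_j \sum_(0 <= k < N j) a j k * (Z:[j, k.+1] - Z:[j, k]) =
  \sum_j (c j * Z:[j, 0] + d j * Z:[j, N j]
    - \sum_(1 <= k < N j) f j k * Z:[j, k]).
Proof.
move=> Zc af ac; rewrite -[RHS]subr0 -[X in _ - X](Kirchhoff_test Zc ac) -sumrB.
apply: eq_bigr => j _.
rewrite (sum_by_parts (a j) (fun k => Z:[j, k])) ?npts_gt0//.
rewrite (@eq_big_nat _ _ _ 1 (N j) (fun k => (a j k - a j k.-1) * Z:[j, k])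
  (fun k => f j k * Z:[j, k])); first by ring.
move=> k /andP[k1 kN]; rewrite af// k1/= -ltnS prednK//.
by rewrite npts_gt0.
Qed.

Lemma inner2E (U W : GF) : inner2 U W =
  \sum_j (\sum_(1 <= k < N j) h j * U:[j, k] * W:[j, k]
    + (h j / 2 * U:[j, 0] * W:[j, 0] + h j / 2 * U:[j, N j] * W:[j, N j])).
Proof.
by rewrite /inner2 big_split/= sum_Inc_plus sum_Inc_minus -!big_split.
Qed.

Lemma inner2Bl (U W Z : GF) :
  inner2 (U - W) Z = inner2 U Z - inner2 W Z.
Proof.
rewrite !inner2E -sumrB; apply: eq_bigr => j _.
rewrite (eq_bigr (fun k => h j * U:[j, k] * Z:[j, k]
                           - h j * W:[j, k] * Z:[j, k])).
  by rewrite sumrB !gvalB; ring.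
by move=> k _; rewrite gvalB; ring.
Qed.

Lemma inner2_cst (c : R) (Z : GF) :
  inner2 (cst_grid N c) Z = c * inner2 Z (cst_grid N 1).
Proof.
rewrite !inner2E mulr_sumr; apply: eq_bigr => j _.
rewrite mulrDr mulr_sumr !gval_cst; congr (_ + _); last by ring.
by apply: eq_bigr => k _; rewrite !gval_cst; ring.
Qed.

(** The half weights at both ends of an edge make the total weight of the edge
    its length. *)
Lemma inner2_mass (c : R) :
  inner2 (cst_grid N c) (cst_grid N 1) = c * \sum_j len G j.
Proof.
rewrite inner2E mulr_sumr; apply: eq_bigr => j _.
rewrite (eq_bigr (fun=> h j * c)); last by move=> k _; rewrite !gval_cst mulr1.
rewrite sumr_const_nat !gval_cst.
have -> : len G j = (N j)%:R * h j by rewrite nptsE divfK// gt_eqF// step_gt0.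
by rewrite -[X in X + _ = _]mulr_natr natrB ?npts_gt0//; field.
Qed.

(** * Weak formulations of the two equations *)

Section Tested.
Context (nu : J -> R) (g : J -> R -> R * R -> R).

Definition energy (U W : GF) : R :=
  \sum_j \sum_(0 <= k < N j) nu j * h j * Dplus U j k * Dplus W j k.

Lemma energyC U W : energy U W = energy W U.
Proof. by apply: eq_bigr => j _; apply: eq_bigr => k _; ring. Qed.

Lemma energyBl U W Z : energy (U - W) Z = energy U Z - energy W Z.
Proof.
rewrite /energy -sumrB; apply: eq_bigr => j _; rewrite -sumrB.
by apply: eq_bigr => k _; rewrite DplusB; ring.
Qed.

(** The advective flux through the link between the points [k] and [k.+1]. The
    densities at the two end points of an edge do not contribute to it, whence
    the truncations in [Bh] and the shape of the transition condition [Th]. *)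
Definition drift (U M : GF) j k : R :=
  (if k == 0 then 0 else M:[j, k] * g1 g U j k)
  + (if k == (N j).-1 then 0 else M:[j, k.+1] * g2 g U j k.+1).

Lemma Bh_drift (U M : GF) j k : (1 <= k <= (N j).-1)%N ->
  h j * Bh g U M j k = drift U M j k - drift U M j k.-1.
Proof.
case: k => // k /= kN; rewrite /Bh mulVKf /drift/=;
  last by rewrite gt_eqF// step_gt0.
rewrite (ltn_eqF kN) eqSS; case: (k == 0%N); case: (k.+1 == _); ring.
Qed.

(** The advection term of the Fokker-Planck equation is the adjoint of the
    linearized Hamiltonian: regrouping by grid point instead of by link, each
    [M:[j, k]] is multiplied by the derivative of [g] in the direction of
    [Dh W j k]. *)
Lemma sum_drift (U M W : GF) j :
  \sum_(0 <= k < N j) drift U M j k * (W:[j, k.+1] - W:[j, k]) =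
  \sum_(1 <= k < N j) h j * M:[j, k] *
    (g1 g U j k * Dplus W j k + g2 g U j k * Dplus W j k.-1).
Proof.
have := npts_gt0 j; rewrite /drift; case: (N j) => // m _ /=.
rewrite (eq_bigr (fun k =>
   (if k == 0 then 0 else M:[j, k] * g1 g U j k)
    * (W:[j, k.+1] - W:[j, k])
  + (if k == m then 0 else M:[j, k.+1] * g2 g U j k.+1)
    * (W:[j, k.+1] - W:[j, k])));
  last by move=> k _; rewrite mulrDl.
rewrite big_split/= [X in X + _]big_nat_recl//= mul0r add0r.
rewrite [X in _ + X]big_nat_recr//= eqxx mul0r addr0 big_add1/= -big_split.
apply: eq_big_nat => k /andP[_ km] /=.
by rewrite (ltn_eqF km) -!Dplus_step; ring.
Qed.

(** The total flux [nu D^+M + drift] is constant along edges and balanced at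
    vertices, so the Green formula has no source. *)
Lemma fp_tested (U M W : GF) : grid_continuous W ->
  (forall j k, (1 <= k <= (N j).-1)%N ->
     nu j * D2h M j k + Bh g U M j k = 0) ->
  (forall i, Th nu g M U i = 0) ->
  energy M W + \sum_j \sum_(1 <= k < N j) h j * M:[j, k] *
    (g1 g U j k * Dplus W j k + g2 g U j k * Dplus W j k.-1) = 0.
Proof.
move=> Wc FP TH.
pose a j k := nu j * Dplus M j k + drift U M j k.
have af j k : (1 <= k <= (N j).-1)%N -> a j k - a j k.-1 = 0.
  move=> kN; have := FP j k kN; move/(congr1 ( *%R (h j))).
  rewrite mulr0 mulrDr (Bh_drift U M kN) mulrCA D2h_flux; last by case/andP: kN.
  by move=> <-; rewrite /a; ring.
(* At an end link only one of the two terms of the drift is present. *)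
have N1 j : (0 == (N j).-1) = false.
  by have := npts_ge2 D j; case: (N j) => [|[]].
have ac i : \sum_(j in Inc_plus G i) (a j 0 + 0)
     - \sum_(j in Inc_minus G i) (a j (N j).-1 - 0) = 0.
  rewrite -[RHS](TH i) /Th; congr (_ - _); apply: eq_bigr => j _.
    by rewrite /a /drift eqxx N1 addr0 add0r.
  by rewrite /a /drift eqxx eq_sym N1 addr0 subr0.
have := network_Green Wc af ac; rewrite [RHS]big1; last first.
  move=> j _; rewrite !mul0r addr0 big1 ?subr0// => k _; exact: mul0r.
move=> flux0; rewrite -[RHS]flux0 /energy -big_split; apply: eq_bigr => j _ /=.
rewrite -sum_drift -big_split; apply: eq_bigr => k _ /=.
by rewrite -!Dplus_step /a; ring.
Qed.

(** The half weighted vertex terms of [Sh] are exactly the vertex part of the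
    inner product of [F - L] with [Z]. *)
Lemma hjb_tested (F U Z : GF) L : grid_continuous Z ->
  (forall j k, (1 <= k <= (N j).-1)%N ->
     - nu j * D2h U j k + gat D g j k (Dh U j k) + L = F:[j, k]) ->
  (forall i, Sh nu U (F - cst_grid N L) i = 0) ->
  energy U Z + \sum_j \sum_(1 <= k < N j)
      h j * gat D g j k (Dh U j k) * Z:[j, k]
  = inner2 F Z - L * inner2 Z (cst_grid N 1).
Proof.
move=> Zc HJ SH.
pose a j k := nu j * Dplus U j k.
pose f j k := h j * (gat D g j k (Dh U j k) - (F - cst_grid N L):[j, k]).
have af j k : (1 <= k <= (N j).-1)%N -> a j k - a j k.-1 = f j k.
  move=> kN; rewrite /f gvalB gval_cst -HJ// /a -mulrBr -D2h_flux; first ring.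
  by case/andP: kN.
have := @network_Green Z a f (fun j => h j / 2 * (F - cst_grid N L):[j, 0])
  (fun j => h j / 2 * (F - cst_grid N L):[j, N j]) Zc af SH.
move=> H; rewrite -inner2_cst -inner2Bl inner2E.
have -> : energy U Z =
    \sum_j \sum_(0 <= k < N j) a j k * (Z:[j, k.+1] - Z:[j, k]).
  apply: eq_bigr => j _; apply: eq_bigr => k _; rewrite -Dplus_step /a; ring.
rewrite H -big_split; apply: eq_bigr => j _ /=.
rewrite -addrA addrC [X in X + _]addrC; congr (_ + _).
rewrite -sumrN -big_split; apply: eq_bigr => k _ /=; rewrite /f; ring.
Qed.

End Tested.
End Grid.

(** * Monotonicity: uniqueness of the mass *)

Section Mass.
Context {R : realType} {n : nat} {I J : finType} (G : network R n I J).
Context (D : discretization (len G)).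
Local Notation h := (step D).
Local Notation N := (npts D).
Local Notation GF := (gridfun R N).
Context (nu : J -> R) (g : J -> R -> R * R -> R) (V : GF -> GF).
Context (hC1 : numH_C1 (len G) g).
Context (hconv : numH_convex (len G) g).

Lemma gat_gradient (U W : GF) j k : (k <= N j)%N ->
  gat D g j k (Dh U j k)
  + (g1 g U j k * (Dplus W j k - Dplus U j k)
     + g2 g U j k * (Dplus W j k.-1 - Dplus U j k.-1))
  <= gat D g j k (Dh W j k).
Proof.
move=> /(ypt_in (D := D)) yk;
exact: (@convex_gradient _ (g j (ypt D j k)) (Dh U j k) (Dh W j k) (hconv yk)
  (numH_differentiable _ hC1 yk)).
Qed.

(** The Lasry-Lions computation: the energies cancel by symmetry, and what
    remains is a sum of convexity defects weighted by the nonnegative masses.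
    *)
Lemma mfg_monotonicity (U M U' M' : GF) L L' :
  mfg_solution nu g V U M L -> mfg_solution nu g V U' M' L' ->
  inner2 (V M - V M') (M - M') <= 0.
Proof.
move=> [HJ FP BC [Mc M0 M1] _] [HJ' FP' BC' [Mc' M0' M1'] _].
have Uc i : grid_continuous_at U i by case: (BC i).
have Uc' i : grid_continuous_at U' i by case: (BC' i).
have Zc : grid_continuous (M - M').
  by move=> i p q ip iq; rewrite !ffunE (Mc i p q ip iq) (Mc' i p q ip iq).
have Wc : grid_continuous (U - U').
  by move=> i p q ip iq; rewrite !ffunE (Uc i p q ip iq) (Uc' i p q ip iq).
have SH i : Sh nu U (V M - cst_grid N L) i = 0 by case: (BC i).
have SH' i : Sh nu U' (V M' - cst_grid N L') i = 0 by case: (BC' i).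
have TH i : Th nu g M U i = 0 by case: (BC i).
have TH' i : Th nu g M' U' i = 0 by case: (BC' i).
have Z0 : inner2 (M - M') (cst_grid N 1) = 0 by rewrite inner2Bl M1 M1' subrr.
have hU := hjb_tested Zc HJ SH; have hU' := hjb_tested Zc HJ' SH'.
rewrite Z0 mulr0 subr0 in hU; rewrite Z0 mulr0 subr0 in hU'.
have fM := fp_tested Wc FP TH; have fM' := fp_tested Wc FP' TH'.
have key : energy nu U (M - M') - energy nu U' (M - M') =
  energy nu M (U - U') - energy nu M' (U - U').
  by rewrite -!energyBl energyC.
rewrite inner2Bl -hU -hU'.
rewrite opprD addrACA key.
(* Fokker-Planck turns the energies into advection terms, and the inequality
   then holds at each grid point. *)
move/eqP: fM; rewrite addr_eq0 => /eqP ->.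
move/eqP: fM'; rewrite addr_eq0 => /eqP ->.
rewrite opprK addrC -!sumrN -!big_split /=; apply: sumr_le0 => j _.
rewrite -!sumrN -!big_split big_nat_cond /=.
apply: sumr_le0 => k /andP[/andP[_ /ltnW kN] _].
have Mk : 0 <= h j * M:[j, k].
  by apply: mulr_ge0; [exact: ltW (step_gt0 D j) | exact: M0].
have Mk' : 0 <= h j * M':[j, k].
  by apply: mulr_ge0; [exact: ltW (step_gt0 D j) | exact: M0'].
have := ler_wpM2l Mk (gat_gradient U U' kN).
have := ler_wpM2l Mk' (gat_gradient U' U kN).
rewrite !gvalB !DplusB; lra.
Qed.

End Mass.

(** * Strong maximum principle: uniqueness of the value function *)

Section MaximumPrinciple.
Context {R : realType} {n : nat} {I J : finType} (G : network R n I J).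
Context (D : discretization (len G)).
Local Notation h := (step D).
Local Notation N := (npts D).
Local Notation GF := (gridfun R N).
Context (nu : J -> R) (g : J -> R -> R * R -> R).
Context (hG : connected_network G).
Context (hnu : forall j, 0 < nu j).
Context (hmono : numH_monotone (len G) g).
Context (F U U' : GF) (L L' : R).
Context (HJ : forall j k, (1 <= k <= (N j).-1)%N ->
  - nu j * D2h U j k + gat D g j k (Dh U j k) + L = F:[j, k]).
Context (HJ' : forall j k, (1 <= k <= (N j).-1)%N ->
  - nu j * D2h U' j k + gat D g j k (Dh U' j k) + L' = F:[j, k]).
Context (SH : forall i, Sh nu U (F - cst_grid N L) i = 0).
Context (SH' : forall i, Sh nu U' (F - cst_grid N L') i = 0).
Context (LL : L' <= L).

Local Notation W := (U - U').

(** At a maximum point of [W], monotonicity gives [g(DU') <= g(DU)], which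
    with [L' <= L] forces [D2h W] to be nonnegative; at a maximum this leaves
    no room for a neighbour with a smaller value. *)
Lemma interior_max j k : (1 <= k <= (N j).-1)%N ->
  W:[j, k.-1] <= W:[j, k] -> W:[j, k.+1] <= W:[j, k] ->
  W:[j, k.-1] = W:[j, k] /\ W:[j, k.+1] = W:[j, k].
Proof.
move=> k1N Wm Wp; have /andP[k0 kN1] := k1N.
have kN : (k <= N j)%N by rewrite (leq_trans kN1) ?leq_pred.
have hj := step_gt0 D j.
have Dp : Dplus W j k <= 0 by rewrite /Dplus pmulr_lle0 ?invr_gt0// subr_le0.
have Dm : 0 <= Dplus W j k.-1.
  by rewrite /Dplus divr_ge0 ?subr_ge0 ?(prednK k0)// ltW.
have gle : gat D g j k (Dh U' j k) <= gat D g j k (Dh U j k).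
  have [gq1 gq2] := hmono (ypt_in (D := D) kN).
  move: Dp Dm; rewrite !DplusB subr_le0 subr_ge0 => Dp Dm.
  exact: le_trans (gq2 _ _ _ Dm) (gq1 _ _ _ Dp).
have D0 : 0 <= nu j * (Dplus W j k - Dplus W j k.-1).
  rewrite !DplusB.
  have -> : nu j * (Dplus U j k - Dplus U' j k
                    - (Dplus U j k.-1 - Dplus U' j k.-1))
     = h j * (nu j * D2h U j k - nu j * D2h U' j k).
    rewrite [RHS]mulrBr !(mulrCA (h j) (nu j)) !D2h_flux//; ring.
  apply: mulr_ge0; first exact: ltW.
  have -> : nu j * D2h U j k - nu j * D2h U' j k =
    (gat D g j k (Dh U j k) - gat D g j k (Dh U' j k)) + (L - L').
    have /eqP := etrans (HJ k1N) (esym (HJ' k1N)).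
    by rewrite -subr_eq0 => /eqP E; apply/eqP;
      rewrite -subr_eq0 -oppr_eq0 -[X in _ == X]E; apply/eqP; ring.
  by rewrite addr_ge0// subr_ge0.
rewrite pmulr_rge0 ?hnu// subr_ge0 in D0.
have Dm0 : Dplus W j k.-1 = 0 by apply/eqP; rewrite eq_le Dm (le_trans D0).
have Dp0 : Dplus W j k = 0 by apply/eqP; rewrite eq_le Dp (le_trans Dm).
have := Dplus_step W j k; have := Dplus_step W j k.-1.
rewrite Dm0 Dp0 (prednK k0) mulr0 => /esym/eqP + /esym/eqP.
by rewrite !subr_eq0 => /eqP -> /eqP ->.
Qed.

(** The difference of the transition conditions at a vertex does not involve
    [g]: it is a vanishing sum of the outward slopes of [- W] along the edges
    and of multiples of [L - L'], all of them nonnegative at a maximum. *)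
Lemma vertex_max i :
  (forall j, j \in Inc_plus G i -> W:[j, 1] <= W:[j, 0]) ->
  (forall j, j \in Inc_minus G i -> W:[j, (N j).-1] <= W:[j, N j]) ->
  (forall j, j \in Inc_plus G i -> W:[j, 1] = W:[j, 0]) /\
  (forall j, j \in Inc_minus G i -> W:[j, (N j).-1] = W:[j, N j]).
Proof.
move=> Wp Wm.
pose a j := nu j * (- Dplus W j 0) + h j / 2 * (L - L').
pose b j := nu j * Dplus W j (N j).-1 + h j / 2 * (L - L').
have hL j : 0 <= h j / 2 * (L - L').
  by rewrite mulr_ge0 ?subr_ge0// divr_ge0// ltW// step_gt0.
have slope0 j : j \in Inc_plus G i -> 0 <= nu j * (- Dplus W j 0).
  move=> ji; rewrite mulr_ge0 ?(ltW (hnu j))// oppr_ge0.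
  by rewrite /Dplus pmulr_lle0 ?invr_gt0 ?step_gt0// subr_le0 Wp.
have slopeN j : j \in Inc_minus G i -> 0 <= nu j * Dplus W j (N j).-1.
  move=> ji; rewrite mulr_ge0 ?(ltW (hnu j))// /Dplus (prednK (npts_gt0 D j)).
  by rewrite divr_ge0 ?(ltW (step_gt0 D j))// subr_ge0 Wm.
have a0 j : j \in Inc_plus G i -> 0 <= a j by move=> /slope0 /addr_ge0; exact.
have b0 j : j \in Inc_minus G i -> 0 <= b j by move=> /slopeN /addr_ge0; exact.
have ab : \sum_(j in Inc_plus G i) a j + \sum_(j in Inc_minus G i) b j = 0.
  have : Sh nu U' (F - cst_grid N L') i - Sh nu U (F - cst_grid N L) i = 0.
    by rewrite SH SH' subrr.
  rewrite /Sh opprD addrACA opprK [X in _ + X]addrC -!sumrB => S0.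
  rewrite -[RHS]S0.
  by congr (_ + _); apply: eq_bigr => j _;
    rewrite /a /b !DplusB !gvalB !gval_cst; ring.
move/eqP: ab; rewrite paddr_eq0 ?sumr_ge0//.
rewrite !psumr_eq0// => /andP[/allP sa0 /allP sb0]; split=> j ji.
  have := sa0 j (mem_index_enum _); rewrite ji/= /a paddr_eq0 ?slope0//.
  rewrite mulf_eq0 gt_eqF//= oppr_eq0 => /andP[/eqP D0 _].
  by apply/eqP; rewrite -subr_eq0 -Dplus_step D0 mulr0.
have := sb0 j (mem_index_enum _); rewrite ji/= /b paddr_eq0 ?slopeN//.
rewrite mulf_eq0 gt_eqF//= => /andP[/eqP D0 _]; apply/esym/eqP.
have := Dplus_step W j (N j).-1; rewrite D0 mulr0 (prednK (npts_gt0 D j)).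
by move=> /esym/eqP; rewrite subr_eq0.
Qed.

Context (Wc : grid_continuous W).
Context (m : R).
Context (Wm : forall j k, W:[j, k] <= m).

(** This is the property [W = m] at the vertex [i], expressed at the ends of
    all the edges that meet there since [W] lives on the edges. *)
Definition top_at i :=
  (forall j, j \in Inc_plus G i -> W:[j, 0] = m) /\
  (forall j, j \in Inc_minus G i -> W:[j, N j] = m).

Lemma top_at_start i j : j \in Inc_plus G i -> W:[j, 0] = m -> top_at i.
Proof.
move=> ji Wj; have [c [cp cm]] := vertex_value (@Wc i).
by have mc : m = c; [rewrite -Wj cp | rewrite /top_at mc].
Qed.

Lemma top_at_end i j : j \in Inc_minus G i -> W:[j, N j] = m -> top_at i.
Proof.
move=> ji Wj; have [c [cp cm]] := vertex_value (@Wc i).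
by have mc : m = c; [rewrite -Wj cm | rewrite /top_at mc].
Qed.

Lemma top_at_neighbours i : top_at i ->
  (forall j, j \in Inc_plus G i -> W:[j, 1] = m) /\
  (forall j, j \in Inc_minus G i -> W:[j, (N j).-1] = m).
Proof.
move=> [tp tm]; case: (@vertex_max i) => [j ji|j ji|vp vm].
- by rewrite tp.
- by rewrite tm.
- by split=> j ji; rewrite ?vp ?tp ?vm ?tm.
Qed.

Lemma top_up j k : (k < N j)%N -> W:[j, k] = m -> W:[j, k.+1] = m.
Proof.
case: k => [_ Wj|k kN Wj].
  have [i ji] := par_start G j.
  have {}ji : j \in Inc_plus G i by rewrite inE ji.
  by have [/(_ j ji)] := top_at_neighbours (top_at_start ji Wj).
have k1 : (1 <= k.+1 <= (N j).-1)%N by rewrite /= -ltnS prednK// npts_gt0.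
by case: (interior_max k1) => [||_ ->]; rewrite ?Wj.
Qed.

Lemma top_down j k : (k < N j)%N -> W:[j, k.+1] = m -> W:[j, k] = m.
Proof.
rewrite leq_eqVlt => /predU1P[kN|kN] Wj.
  have [i ji] := par_end G j.
  have {}ji : j \in Inc_minus G i by rewrite inE ji.
  rewrite kN in Wj.
  by have [_ /(_ j ji)] := top_at_neighbours (top_at_end ji Wj); rewrite -kN.
have k1 : (1 <= k.+1 <= (N j).-1)%N by rewrite /= -ltnS prednK// npts_gt0.
by case: (interior_max k1) => [||-> _]; rewrite ?Wj.
Qed.

Lemma top_edge j k0 : (k0 <= N j)%N -> W:[j, k0] = m ->
  forall k, (k <= N j)%N -> W:[j, k] = m.
Proof.
move=> k0N Wj.
have W0 : W:[j, 0] = m.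
  by elim: k0 k0N Wj => // k IH kN /(top_down kN); apply: IH; exact: ltnW.
by elim=> // k IH kN; apply: top_up => //; apply: IH; exact: ltnW.
Qed.

Lemma top_at_Inc i j : j \in Inc G i ->
  (forall k, (k <= N j)%N -> W:[j, k] = m) <-> top_at i.
Proof.
rewrite inE => /orP[] ji; split=> [Wj|[tp tm]].
- by apply: top_at_start ji _; exact: Wj.
- by apply: (@top_edge j 0) => //; exact: tp.
- by apply: top_at_end ji _; exact: Wj.
- by apply: (@top_edge j (N j)) => //; exact: tm.
Qed.

Lemma top_everywhere j0 k0 : (k0 <= N j0)%N -> W:[j0, k0] = m ->
  forall j k, (k <= N j)%N -> W:[j, k] = m.
Proof.
move=> k0N Wj0 j; have [i0 ji0] := par_start G j0.
have [i ji] := par_start G j.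
have {}ji0 : j0 \in Inc G i0 by rewrite !inE ji0 eqxx.
have {}ji : j \in Inc G i by rewrite !inE ji eqxx.
apply/(top_at_Inc ji).
have top0 : top_at i0 by apply/(top_at_Inc ji0); exact: top_edge k0N Wj0.
have /connectP[p pth ->] := hG i0 i.
elim: p i0 {ji0} top0 pth => //= i1 p IH i0 top0.
move=> /andP[/existsP[e /andP[e0 e1]] pth].
by apply: IH pth; apply/(top_at_Inc e1)/(top_at_Inc e0).
Qed.

End MaximumPrinciple.

Section Uniqueness.
Context {R : realType} {n : nat} {I J : finType} (G : network R n I J).
Context (D : discretization (len G)).
Local Notation N := (npts D).
Local Notation GF := (gridfun R N).
Context (nu : J -> R) (g : J -> R -> R * R -> R).
Context (hG : connected_network G).
Context (hnu : forall j, 0 < nu j).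
Context (hmono : numH_monotone (len G) g).

(** The first argument, an edge, excludes the empty network, on which the
    constants [L] and [L'] would be arbitrary. *)
Lemma hjb_unique (F U U' : GF) (L L' : R) : J ->
  (forall j k, (1 <= k <= (N j).-1)%N ->
    - nu j * D2h U j k + gat D g j k (Dh U j k) + L = F:[j, k]) ->
  (forall j k, (1 <= k <= (N j).-1)%N ->
    - nu j * D2h U' j k + gat D g j k (Dh U' j k) + L' = F:[j, k]) ->
  (forall i, Sh nu U (F - cst_grid N L) i = 0) ->
  (forall i, Sh nu U' (F - cst_grid N L') i = 0) ->
  grid_continuous U -> grid_continuous U' ->
  inner2 U (cst_grid N 1) = 0 -> inner2 U' (cst_grid N 1) = 0 ->
  U = U' /\ L = L'.
Proof.
move=> j0.
(* The roles of the two solutions are symmetric, and the maximum principle for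
   U - U' uses the order of the constants. *)
wlog LL : U U' L L' / L' <= L => [wlg|] HJ HJ' SH SH' Uc Uc' U0 U0'.
  have [LL|/ltW LL] := leP L' L; first exact: wlg.
  by have [-> ->] := wlg U' U L' L LL HJ' HJ SH' SH Uc' Uc U0' U0.
have Wc : grid_continuous (U - U').
  by move=> i p q ip iq; rewrite !ffunE (Uc i p q ip iq) (Uc' i p q ip iq).
pose p0 : {j : J & 'I_(N j).+1} :=
  Tagged (fun j => 'I_(N j).+1) (ord0 : 'I_(N j0).+1).
case: (@arg_maxP _ _ _ p0 xpredT (fun p => (U - U') p) isT)
  => -[j1 k1] _ pmax.
set m := (U - U') _ in pmax.
have Wm j k : (U - U'):[j, k] <= m by exact: pmax.
have k1N : (k1 <= N j1)%N by rewrite -ltnS.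
have Wk1 : (U - U'):[j1, k1] = m by rewrite /gval inord_val.
have Wtop := top_everywhere hG hnu hmono HJ HJ' SH SH' LL Wc Wm k1N Wk1.
have Wcst : U - U' = cst_grid N m.
  by apply: gval_ext => j k kN; rewrite Wtop// gval_cst.
have m0 : m = 0.
  have := inner2_mass D m; rewrite -Wcst inner2Bl U0 U0' subrr => /esym/eqP.
  rewrite mulf_eq0 => /orP[/eqP//|].
  by rewrite psumr_eq0 => [/allP/(_ j0 (mem_index_enum _))|j _];
    rewrite ?ltW ?gt_eqF ?len_gt0.
have UU : U = U'.
  by apply/eqP; rewrite -subr_eq0 Wcst m0; apply/eqP/ffunP => p; rewrite !ffunE.
split=> //.
have k11 : (1 <= 1 <= (N j0).-1)%N by
  rewrite /= -ltnS prednK ?npts_gt0 ?npts_ge2.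
by have := HJ _ _ k11; rewrite -(HJ' _ _ k11) UU => /addrI.
Qed.

End Uniqueness.

Theorem theorem3p2 (R : realType) (n : nat) (I J : finType)
  (G : network R n I J) (hG : connected_network G)
  (nu : J -> R) (hnu : forall j, 0 < nu j)
  (D : discretization (len G))
  (H : J -> R -> R -> R) (hH : is_hamiltonian (len G) H)
  (g : J -> R -> R * R -> R)
  (hmono : numH_monotone (len G) g)
  (hcons : numH_consistent (len G) g H)
  (hC1 : numH_C1 (len G) g)
  (hcoer : numH_coercive (len G) g)
  (hconv : numH_convex (len G) g)
  (V : gridfun R (npts D) -> gridfun R (npts D))
  (hV : strictly_monotone V)
  (U M U' M' : gridfun R (npts D)) (L L' : R) :
  mfg_solution nu g V U M L -> mfg_solution nu g V U' M' L' ->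
  [/\ U = U', M = M' & L = L'].
Proof.
move=> sol sol'; have mono := mfg_monotonicity hC1 hconv sol sol'.
move: sol sol' => [HJ _ BC KM U0] [HJ' _ BC' KM' U0'].
have MM := hV M M' KM KM' mono; rewrite -MM in HJ' BC'.
(* A network without edges carries no mass. *)
have [j0|noJ] := pickP (fun _ : J => true); last first.
  have [_ _] := KM; rewrite inner2E big1 => [|j _]; last by have := noJ j.
  by move=> /eqP; rewrite eq_sym oner_eq0.
have Uc i : grid_continuous_at U i by case: (BC i).
have Uc' i : grid_continuous_at U' i by case: (BC' i).
have SH i : Sh nu U (V M - cst_grid (npts D) L) i = 0 by case: (BC i).
have SH' i : Sh nu U' (V M - cst_grid (npts D) L') i = 0 by case: (BC' i).
by have [] := hjb_unique hG hnu hmono j0 HJ HJ' SH SH' Uc Uc' U0 U0'.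
Qed.
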